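(* If $\kappa$ is unfoldable, then $\kappa$ is weakly compact.
   Context: $\mathcal{R}(\kappa)=V_\kappa$ is the set of all sets of rank less than $\kappa$. For structures $\mathfrak{A}=(M,E,\dots)$ and $\mathfrak{B}=(N,F,\dots)$ in the same language, $\mathfrak{B}$ is an end elementary extension (eee) of $\mathfrak{A}$, written $\mathfrak{A}\prec_e\mathfrak{B}$, if $\mathfrak{B}$ is a proper elementary extension of $\mathfrak{A}$ and for every $a\in M$, $\{b\in M : bEa\}=\{b\in N: bFa\}$. $o(M)$ denotes the ordinal height of $M$. A cardinal $\kappa$ is unfoldable if it is inaccessible and for every ordinal $\alpha$ and every $S\subset\mathcal{R}(\kappa)$ there is a well-founded eee $M$ of $(\mathcal{R}(\kappa),\in,S)$ with $o(M)\geq\alpha$. *)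

(* Defs.v *)
From Stdlib Require Import Classical ClassicalEpsilon.
From Stdlib Require Import FunctionalExtensionality PropExtensionality ProofIrrelevance.

(** * The universe of sets

    Aczel's well-founded trees, taken modulo bisimilarity so that equality of
    sets is Leibniz equality. *)

Inductive PSet : Type := psup (A : Type) (f : A -> PSet).

Definition idx (p : PSet) : Type := let (A, _) := p in A.
Definition elt (p : PSet) : idx p -> PSet :=
  match p with psup A f => f end.

Fixpoint PEq (p q : PSet) : Prop :=
  match p, q with
  | psup A f, psup B g =>
      (forall a, exists b, PEq (f a) (g b)) /\
      (forall b, exists a, PEq (f a) (g b))
  end.

Definition PMem (p q : PSet) : Prop := exists b : idx q, PEq p (elt q b).

Definition punion {A : Type} (g : A -> PSet) : PSet :=
  psup {a : A & idx (g a)} (fun s => elt (g (projT1 s)) (projT2 s)).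

Definition psucc (p : PSet) : PSet :=
  psup (option (idx p))
       (fun o => match o with Some b => elt p b | None => p end).

Definition ppow (p : PSet) : PSet :=
  psup (idx p -> Prop)
       (fun P => psup {b : idx p | P b} (fun s => elt p (proj1_sig s))).

Fixpoint prank (p : PSet) : PSet :=
  match p with psup A f => punion (fun a => psucc (prank (f a))) end.

Fixpoint pV (p : PSet) : PSet :=
  match p with psup A f => punion (fun a => ppow (pV (f a))) end.

Record ZFSet : Type := MkZFSet {
  cls : PSet -> Prop;
  cls_spec : exists p, cls = PEq p
}.

Definition toZF (p : PSet) : ZFSet := MkZFSet (PEq p) (ex_intro _ p eq_refl).

Definition repr (a : ZFSet) : PSet :=
  proj1_sig (constructive_indefinite_description _ (cls_spec a)).

Definition mem (a b : ZFSet) : Prop := PMem (repr a) (repr b).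

Declare Scope zf_scope.
Delimit Scope zf_scope with zf.
Infix "∈" := mem (at level 70, no associativity) : zf_scope.
Local Open Scope zf_scope.

Definition subset (a b : ZFSet) : Prop := forall x, x ∈ a -> x ∈ b.
Infix "⊆" := subset (at level 70, no associativity) : zf_scope.

Definition pow (a : ZFSet) : ZFSet := toZF (ppow (repr a)).

Definition rank (a : ZFSet) : ZFSet := toZF (prank (repr a)).

(** [V a] is the union over [b ∈ a] of the power sets of [V b]; lemma [mem_V_rank]
    below shows that, for an ordinal [a], its elements are exactly the sets of
    rank less than [a]. *)
Definition V (a : ZFSet) : ZFSet := toZF (pV (repr a)).

Definition transitive (a : ZFSet) : Prop := forall x, x ∈ a -> x ⊆ a.

Definition ordinal (a : ZFSet) : Prop :=
  transitive a /\ forall x, x ∈ a -> transitive x.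

(** * Basic facts about the universe *)

Lemma PEq_refl p : PEq p p.
Proof.
induction p as [A f IH]; simpl; split; intros a; exists a; apply IH.
Qed.

Lemma PEq_sym p : forall q, PEq p q -> PEq q p.
Proof.
induction p as [A f IH]; intros [B g] [h1 h2]; split.
- intros b; destruct (h2 b) as [a h]; exists a; auto.
- intros a; destruct (h1 a) as [b h]; exists b; auto.
Qed.

Lemma PEq_trans p : forall q r, PEq p q -> PEq q r -> PEq p r.
Proof.
induction p as [A f IH]; intros [B g] [C h] [k1 k2] [l1 l2]; split.
- intros a; destruct (k1 a) as [b h1]; destruct (l1 b) as [c h2]; eauto.
- intros c; destruct (l2 c) as [b h2]; destruct (k2 b) as [a h1]; eauto.
Qed.

Lemma PMem_elt p b : PMem (elt p b) p.
Proof. exists b; apply PEq_refl. Qed.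

Lemma PEq_ext p q : (forall r, PMem r p <-> PMem r q) -> PEq p q.
Proof.
destruct p as [A f], q as [B g]; intros h; split.
- intros a; destruct (proj1 (h (f a)) (PMem_elt (psup A f) a)) as [b hb]; eauto.
- intros b; destruct (proj2 (h (g b)) (PMem_elt (psup B g) b)) as [a ha].
  exists a; apply PEq_sym; exact ha.
Qed.

Lemma PMem_PEq p p' q q' : PEq p p' -> PEq q q' -> PMem p q -> PMem p' q'.
Proof.
destruct q as [B g], q' as [B' g']; intros hp [h1 _] [b hb].
destruct (h1 b) as [b' hb']; exists b'; simpl in *.
apply PEq_trans with p; [apply PEq_sym; exact hp|].
eapply PEq_trans; eauto.
Qed.

Lemma repr_toZF p : PEq (repr (toZF p)) p.
Proof.
unfold repr; destruct constructive_indefinite_description as [q h]; simpl in *.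
rewrite <- h; apply PEq_refl.
Qed.

Lemma PEq_eq a b : PEq (repr a) (repr b) -> a = b.
Proof.
unfold repr; destruct (constructive_indefinite_description _ (cls_spec a)) as [p hp].
destruct (constructive_indefinite_description _ (cls_spec b)) as [q hq]; simpl.
destruct a as [ca sa], b as [cb sb]; simpl in *; intros h.
assert (e : ca = cb).
{ rewrite hp, hq; apply functional_extensionality; intros r.
  apply propositional_extensionality.
  split; intros k; eapply PEq_trans; eauto using PEq_sym. }
clear hp hq; subst cb; f_equal; apply proof_irrelevance.
Qed.

Lemma toZF_repr a : toZF (repr a) = a.
Proof. apply PEq_eq, repr_toZF. Qed.

Lemma mem_toZF p q : toZF p ∈ toZF q <-> PMem p q.
Proof.
split; apply PMem_PEq; try apply PEq_sym; try apply repr_toZF;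
  apply PEq_sym; apply repr_toZF.
Qed.

Lemma mem_toZF_r a q : a ∈ toZF q <-> PMem (repr a) q.
Proof.
generalize (mem_toZF (repr a) q); rewrite toZF_repr; auto.
Qed.

Lemma elt_mem q i : toZF (elt q i) ∈ toZF q.
Proof. apply mem_toZF, PMem_elt. Qed.

Lemma toZF_eq p q : PEq p q -> toZF p = toZF q.
Proof.
intros h; apply PEq_eq; eapply PEq_trans; [apply repr_toZF|].
eapply PEq_trans; [exact h|]; apply PEq_sym, repr_toZF.
Qed.

Lemma mem_toZF_elt a q : a ∈ toZF q <-> exists i, a = toZF (elt q i).
Proof.
split.
- intros h; apply (proj1 (mem_toZF_r a q)) in h; destruct h as [i hi]; exists i.
  rewrite <- (toZF_repr a); apply toZF_eq; exact hi.
- intros [i ->]; apply elt_mem.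
Qed.

Lemma set_ext a b : (forall x, x ∈ a <-> x ∈ b) -> a = b.
Proof.
intros h; apply PEq_eq, PEq_ext; intros r.
rewrite <- !mem_toZF, !toZF_repr; apply h.
Qed.

Lemma mem_ind (P : ZFSet -> Prop) :
  (forall a, (forall x, x ∈ a -> P x) -> P a) -> forall a, P a.
Proof.
intros hP a; rewrite <- (toZF_repr a); induction (repr a) as [A f IH].
apply hP; intros x hx; apply mem_toZF_elt in hx; destruct hx as [i ->]; apply IH.
Qed.

Lemma mem_toZF_union A (g : A -> PSet) x :
  x ∈ toZF (punion g) <-> exists a, x ∈ toZF (g a).
Proof.
rewrite mem_toZF_elt; split.
- intros [[a i] ->]; exists a; exact (elt_mem (g a) i).
- intros [a h]; apply mem_toZF_elt in h; destruct h as [i ->].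
  exists (existT _ a i); reflexivity.
Qed.

Lemma mem_toZF_succ p x : x ∈ toZF (psucc p) <-> x ∈ toZF p \/ x = toZF p.
Proof.
rewrite !mem_toZF_elt; split.
- intros [[i|] ->]; [left; exists i; reflexivity | right; reflexivity].
- intros [[i ->] | ->]; [exists (Some i) | exists None]; reflexivity.
Qed.

Lemma mem_toZF_pow p x : x ∈ toZF (ppow p) <-> x ⊆ toZF p.
Proof.
split.
- intros h y hy; apply mem_toZF_elt in h; destruct h as [P ->].
  apply mem_toZF_elt in hy; destruct hy as [[i hi] ->]; apply (elt_mem p).
- intros h; apply mem_toZF_elt; exists (fun i => toZF (elt p i) ∈ x).
  apply set_ext; intros y; rewrite mem_toZF_elt; split.
  + intros hy; destruct (proj1 (mem_toZF_elt _ _) (h y hy)) as [i ->].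
    exists (exist (fun i => toZF (elt p i) ∈ x) i hy); reflexivity.
  + intros [[i hi] ->]; exact hi.
Qed.

Lemma mem_pow a x : x ∈ pow a <-> x ⊆ a.
Proof. unfold pow; rewrite mem_toZF_pow, toZF_repr; reflexivity. Qed.

Lemma PEq_prank p : forall q, PEq p q -> toZF (prank p) = toZF (prank q).
Proof.
induction p as [A f IH]; intros [B g] [h1 h2]; apply set_ext; intros x; simpl.
rewrite !mem_toZF_union; split.
- intros [a h]; destruct (h1 a) as [b hb]; exists b; apply IH in hb.
  rewrite mem_toZF_succ in *; rewrite <- hb; exact h.
- intros [b h]; destruct (h2 b) as [a ha]; exists a; apply IH in ha.
  rewrite mem_toZF_succ in *; rewrite ha; exact h.
Qed.

Lemma PEq_pV p : forall q, PEq p q -> toZF (pV p) = toZF (pV q).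
Proof.
induction p as [A f IH]; intros [B g] [h1 h2]; apply set_ext; intros x; simpl.
rewrite !mem_toZF_union; split.
- intros [a h]; destruct (h1 a) as [b hb]; exists b; apply IH in hb.
  rewrite mem_toZF_pow in *; rewrite <- hb; exact h.
- intros [b h]; destruct (h2 b) as [a ha]; exists a; apply IH in ha.
  rewrite mem_toZF_pow in *; rewrite ha; exact h.
Qed.

Lemma rank_toZF p : rank (toZF p) = toZF (prank p).
Proof. apply PEq_prank, repr_toZF. Qed.

Lemma V_toZF p : V (toZF p) = toZF (pV p).
Proof. apply PEq_pV, repr_toZF. Qed.

Lemma mem_rank x z :
  z ∈ rank x <-> exists y, y ∈ x /\ (z ∈ rank y \/ z = rank y).
Proof.
rewrite <- (toZF_repr x), rank_toZF; destruct (repr x) as [A f]; simpl.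
rewrite mem_toZF_union; split.
- intros [a h]; rewrite mem_toZF_succ, <- rank_toZF in h.
  exists (toZF (f a)); split; [apply (elt_mem (psup A f)) | exact h].
- intros [y [hy h]]; apply mem_toZF_elt in hy; destruct hy as [a ->].
  exists a; rewrite mem_toZF_succ, <- rank_toZF; exact h.
Qed.

Lemma mem_V a x : x ∈ V a <-> exists b, b ∈ a /\ x ⊆ V b.
Proof.
rewrite <- (toZF_repr a), V_toZF; destruct (repr a) as [A f]; simpl.
rewrite mem_toZF_union; split.
- intros [i h]; rewrite mem_toZF_pow, <- V_toZF in h.
  exists (toZF (f i)); split; [apply (elt_mem (psup A f)) | exact h].
- intros [y [hy h]]; apply mem_toZF_elt in hy; destruct hy as [i ->].
  exists i; rewrite mem_toZF_pow, <- V_toZF; exact h.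
Qed.

Lemma ordinal_mem a b : ordinal a -> b ∈ a -> ordinal b.
Proof.
intros [ta ha] hb; split; [auto|]; intros x hx; apply ha, (ta b hb); exact hx.
Qed.

Lemma ordinal_total a : forall b, ordinal a -> ordinal b -> a ∈ b \/ a = b \/ b ∈ a.
Proof.
induction a as [a IHa] using mem_ind; induction b as [b IHb] using mem_ind.
intros oa ob; destruct (classic (a ⊆ b)) as [hab | hab].
- destruct (classic (b ⊆ a)) as [hba | hba].
  { right; left; apply set_ext; split; auto. }
  apply not_all_ex_not in hba; destruct hba as [x hx].
  apply imply_to_and in hx; destruct hx as [hxb hxa].
  destruct (IHb x hxb oa (ordinal_mem b x ob hxb)) as [h | [h | h]].
  + left; exact (proj1 ob x hxb a h).
  + left; subst; exact hxb.
  + contradiction.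
- apply not_all_ex_not in hab; destruct hab as [x hx].
  apply imply_to_and in hx; destruct hx as [hxa hxb].
  destruct (IHa x hxa b (ordinal_mem a x oa hxa) ob) as [h | [h | h]].
  + contradiction.
  + right; right; subst; exact hxa.
  + right; right; exact (proj1 oa x hxa b h).
Qed.

Lemma mem_irrefl a : ~ a ∈ a.
Proof. induction a as [a IH] using mem_ind; intros h; exact (IH a h h). Qed.

Lemma ordinal_sub a b : ordinal a -> ordinal b -> a ⊆ b -> a ∈ b \/ a = b.
Proof.
intros oa ob h; destruct (ordinal_total a b oa ob) as [k | [k | k]]; auto.
destruct (mem_irrefl b (h b k)).
Qed.

Lemma ordinal_rank a : ordinal (rank a).
Proof.
induction a as [a IH] using mem_ind; split.
- intros z hz w hw; apply mem_rank in hz; destruct hz as [y [hy hz]].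
  apply mem_rank; exists y; split; [exact hy|]; left.
  destruct hz as [hz | ->]; [exact (proj1 (IH y hy) z hz w hw) | exact hw].
- intros z hz; apply mem_rank in hz; destruct hz as [y [hy [hz | ->]]].
  + exact (proj2 (IH y hy) z hz).
  + exact (proj1 (IH y hy)).
Qed.

Lemma mem_V_rank a : ordinal a -> forall x, x ∈ V a <-> rank x ∈ a.
Proof.
induction a as [a IH] using mem_ind; intros oa x; rewrite mem_V; split.
- intros [b [hb hx]]; assert (ob := ordinal_mem a b oa hb).
  assert (h : rank x ⊆ b).
  { intros z hz; apply mem_rank in hz; destruct hz as [y [hy hz]].
    assert (hr : rank y ∈ b) by (apply (IH b hb ob), hx; exact hy).
    destruct hz as [hz | ->]; [exact (proj1 ob _ hr z hz) | exact hr]. }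
  destruct (ordinal_sub _ b (ordinal_rank x) ob h) as [k | ->].
  + exact (proj1 oa b hb _ k).
  + exact hb.
- intros h; exists (rank x); split; [exact h|]; intros y hy.
  apply (IH _ h (ordinal_rank x)), mem_rank; exists y; auto.
Qed.

(** * Cardinals *)

(** By separation and replacement, the relations and functions between sets that
    are themselves sets are exactly the restrictions to sets of Rocq relations
    [ZFSet -> ZFSet -> Prop] and Rocq functions [ZFSet -> ZFSet], so the Rocq
    objects are used instead of sets of pairs. *)

Definition maps_to (f : ZFSet -> ZFSet) (a b : ZFSet) : Prop :=
  forall x, x ∈ a -> f x ∈ b.

Definition injective_on {T : Type} (f : ZFSet -> T) (a : ZFSet) : Prop :=
  forall x y, x ∈ a -> y ∈ a -> f x = f y -> x = y.

Definition injects (a b : ZFSet) : Prop :=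
  exists f, maps_to f a b /\ injective_on f a.

Definition equinumerous (a b : ZFSet) : Prop :=
  exists f, maps_to f a b /\ injective_on f a /\
            forall y, y ∈ b -> exists x, x ∈ a /\ f x = y.

Definition card_lt (a b : ZFSet) : Prop := injects a b /\ ~ equinumerous a b.

Definition cardinal (k : ZFSet) : Prop :=
  ordinal k /\ forall b, b ∈ k -> ~ equinumerous b k.

Definition uncountable (k : ZFSet) : Prop :=
  ~ exists f : ZFSet -> nat, injective_on f k.

Definition regular (k : ZFSet) : Prop :=
  forall b f, b ∈ k -> maps_to f b k ->
    exists c, c ∈ k /\ forall x, x ∈ b -> f x ∈ c.

Definition strong_limit (k : ZFSet) : Prop :=
  forall b, b ∈ k -> card_lt (pow b) k.

Definition inaccessible (k : ZFSet) : Prop :=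
  cardinal k /\ uncountable k /\ regular k /\ strong_limit k.

(** The partition property [k -> (k)^2_2]: a colouring of the unordered pairs from
    [k] is a function of the pairs [x ∈ y]. *)
Definition partition_property (k : ZFSet) : Prop :=
  forall F : ZFSet -> ZFSet -> bool,
    exists H, H ⊆ k /\ equinumerous H k /\
      exists c : bool, forall x y, x ∈ H -> y ∈ H -> x ∈ y -> F x y = c.

Definition weakly_compact (k : ZFSet) : Prop :=
  cardinal k /\ uncountable k /\ partition_property k.

(** * Structures for the language with one binary and one unary
    predicate symbol

    [rel] and [prd] interpret the symbols; only their restrictions to [dom] matter. *)

Record structure : Type := MkStructure {
  dom : ZFSet;
  rel : ZFSet -> ZFSet -> Prop;
  prd : ZFSet -> Prop
}.

(** Variables are de Bruijn indices. *)
Inductive formula : Type :=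
| fEq (i j : nat)
| fE (i j : nat)
| fS (i : nat)
| fNot (phi : formula)
| fAnd (phi psi : formula)
| fEx (phi : formula).

Definition scons (x : ZFSet) (rho : nat -> ZFSet) (i : nat) : ZFSet :=
  match i with O => x | S j => rho j end.

Fixpoint sat (M : structure) (rho : nat -> ZFSet) (phi : formula) : Prop :=
  match phi with
  | fEq i j => rho i = rho j
  | fE i j => rel M (rho i) (rho j)
  | fS i => prd M (rho i)
  | fNot p => ~ sat M rho p
  | fAnd p q => sat M rho p /\ sat M rho q
  | fEx p => exists x, x ∈ dom M /\ sat M (scons x rho) p
  end.

(** An assignment [rho] has values in [dom A] for all variables, so this is the usual
    notion only for nonempty [A]; it is used for [V k] with [k] uncountable. *)
Definition elementary_extension (A B : structure) : Prop :=
  dom A ⊆ dom B /\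
  forall phi rho, (forall i, rho i ∈ dom A) -> (sat A rho phi <-> sat B rho phi).

(** End elementary extension. *)
Definition eee (A B : structure) : Prop :=
  elementary_extension A B /\ dom A <> dom B /\
  forall a, a ∈ dom A ->
    forall b, (b ∈ dom A /\ rel A b a) <-> (b ∈ dom B /\ rel B b a).

Definition well_founded_structure (M : structure) : Prop :=
  forall X, X ⊆ dom M -> (exists x, x ∈ X) ->
    exists x, x ∈ X /\ forall y, y ∈ X -> ~ rel M y x.

(** [x] is an ordinal in the sense of [M]: [M] satisfies the formula saying that [x]
    is a transitive set of transitive sets. *)

Definition transitive_in (M : structure) (x : ZFSet) : Prop :=
  forall y, y ∈ dom M -> rel M y x ->
  forall z, z ∈ dom M -> rel M z y -> rel M z x.

Definition ordinal_in (M : structure) (x : ZFSet) : Prop :=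
  transitive_in M x /\
  forall y, y ∈ dom M -> rel M y x -> transitive_in M y.

(** [o] is the ordinal height of [M], i.e. the order type under [rel M] of the ordinals
    of [M]; for a transitive [M] with [rel M] the membership relation, [o] is the set of
    ordinals belonging to [M]. *)
Definition ordinal_height (M : structure) (o : ZFSet) : Prop :=
  ordinal o /\
  exists f : ZFSet -> ZFSet,
    (forall x, x ∈ dom M -> ordinal_in M x -> f x ∈ o) /\
    (forall z, z ∈ o -> exists x, x ∈ dom M /\ ordinal_in M x /\ f x = z) /\
    (forall x y, x ∈ dom M -> ordinal_in M x -> y ∈ dom M -> ordinal_in M y ->
       f x = f y -> x = y) /\
    (forall x y, x ∈ dom M -> ordinal_in M x -> y ∈ dom M -> ordinal_in M y ->
       (rel M x y <-> f x ∈ f y)).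

Definition V_structure (k Q : ZFSet) : structure :=
  MkStructure (V k) mem (fun x => x ∈ Q).

Definition unfoldable (k : ZFSet) : Prop :=
  inaccessible k /\
  forall a Q, ordinal a -> Q ⊆ V k ->
    exists N, eee (V_structure k Q) N /\ well_founded_structure N /\
      exists o, ordinal_height N o /\ a ⊆ o.

(* Main.v *)
From Stdlib Require Import Classical ClassicalEpsilon.
From Stdlib Require Import PropExtensionality.
Require Import Defs.
Local Open Scope zf_scope.

(** The proof plays a colouring [F] of the pairs from [kappa] against a new
    ordinal [delta] of an extension.  Code [F] by the set [Q] of all [{x, y}]
    with [x ∈ y ∈ kappa] and [F x y = true], and let [N] be an end elementary
    extension of [(V kappa, ∈, Q)] of height greater than [kappa].  The ordinal
    [delta] of order type [kappa] in [N] lies above every [x ∈ kappa], so each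
    such [x] gets a limit colour [c x], the colour that [N] gives to
    [(x, delta)] ([new_ordinal]).

    The limit colouring as a whole need not belong to [N], but its restriction
    to any [beta ∈ kappa] is an element of [V kappa], with the same elements in
    [N].  As [delta] witnesses in [N] that some ordinal above [beta] has these
    colours with all points below [beta], elementarity gives such an ordinal
    below [kappa] ([limit_colouring]).

    Now collect greedily: keep [x] when [F y x] is the limit colour of [y] for
    all [y ∈ x] kept before.  By the previous paragraph the collection is
    unbounded in [kappa] ([end_homogeneous_unbounded]).  The colour of a pair of
    kept points is the limit colour of its smaller member, so the points of one
    limit colour form a homogeneous set, and one of the two limit colours occurs
    unboundedly often.  Finally, an unbounded subset of a regular [kappa]
    has size [kappa], by transitive collapse ([unbounded_equinumerous]). *)

(** * Sets and recursion along membership *)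

Definition sep (a : ZFSet) (P : ZFSet -> Prop) : ZFSet :=
  toZF (psup {i : idx (repr a) | P (toZF (elt (repr a) i))}
             (fun s => elt (repr a) (proj1_sig s))).

Lemma mem_sep a P x : x ∈ sep a P <-> x ∈ a /\ P x.
Proof.
unfold sep; rewrite mem_toZF_elt; split.
- intros [[i hi] ->]; simpl; split; [|exact hi].
  rewrite <- (toZF_repr a) at 2; apply elt_mem.
- intros [hx hP]; rewrite <- (toZF_repr a), mem_toZF_elt in hx.
  destruct hx as [i ->]; exists (exist _ i hP); reflexivity.
Qed.

Definition image (f : ZFSet -> ZFSet) (a : ZFSet) : ZFSet :=
  toZF (psup (idx (repr a)) (fun i => repr (f (toZF (elt (repr a) i))))).

Lemma mem_image f a z : z ∈ image f a <-> exists y, y ∈ a /\ z = f y.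
Proof.
unfold image; rewrite mem_toZF_elt; simpl; split.
- intros [i ->]; exists (toZF (elt (repr a) i)); rewrite toZF_repr.
  split; [|reflexivity]; rewrite <- (toZF_repr a) at 2; apply elt_mem.
- intros [y [hy ->]]; rewrite <- (toZF_repr a), mem_toZF_elt in hy.
  destruct hy as [i ->]; exists i; rewrite toZF_repr; reflexivity.
Qed.

Definition pair (x y : ZFSet) : ZFSet :=
  toZF (psup bool (fun b => if b then repr x else repr y)).

Lemma mem_pair x y z : z ∈ pair x y <-> z = x \/ z = y.
Proof.
unfold pair; rewrite mem_toZF_elt; simpl; split.
- intros [[|] ->]; rewrite toZF_repr; auto.
- intros [-> | ->]; [exists true | exists false]; symmetry; apply toZF_repr.
Qed.

Definition succ (a : ZFSet) : ZFSet := toZF (psucc (repr a)).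

Lemma mem_succ a x : x ∈ succ a <-> x ∈ a \/ x = a.
Proof. unfold succ; rewrite mem_toZF_succ, toZF_repr; reflexivity. Qed.

Lemma ordinal_succ a : ordinal a -> ordinal (succ a).
Proof.
intros [ta ha]; split.
- intros x hx y hy; apply mem_succ in hx; apply mem_succ; left.
  destruct hx as [hx | ->]; [exact (ta x hx y hy) | exact hy].
- intros x hx; apply mem_succ in hx; destruct hx as [hx | ->]; auto.
Qed.

Lemma mem_wf : well_founded mem.
Proof. intros a; induction a as [a IH] using mem_ind; constructor; exact IH. Qed.

(** The step [Phi] gets a total function so that it can be written without
    membership proofs; the hypothesis says that it looks at it only below its
    first argument. *)
Lemma mem_recursion {T : Type} (d : T) (Phi : ZFSet -> (ZFSet -> T) -> T) :
  (forall x f g, (forall y, y ∈ x -> f y = g y) -> Phi x f = Phi x g) ->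
  exists g, forall x, g x = Phi x g.
Proof.
intros hPhi.
set (step := fun x (rec : forall y, y ∈ x -> T) =>
  Phi x (fun y => match excluded_middle_informative (y ∈ x) with
                  | left h => rec y h
                  | right _ => d
                  end)).
exists (Fix mem_wf (fun _ => T) step); intros x; rewrite Fix_eq.
- apply hPhi; intros y hy.
  destruct (excluded_middle_informative (y ∈ x)); [reflexivity | contradiction].
- intros y f g hfg; apply hPhi; intros z hz.
  destruct (excluded_middle_informative (z ∈ y)); [apply hfg | contradiction].
Qed.

(** * Ordinals in the cumulative hierarchy *)

Lemma ordinal_subset_V b : ordinal b -> b ⊆ V b.
Proof.
induction b as [b IH] using mem_ind; intros ob x hx.
apply mem_V; exists x; eauto using ordinal_mem.
Qed.

Lemma ordinal_mem_V k x : ordinal k -> x ∈ k -> x ∈ V k.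
Proof. intros ok hx; exact (ordinal_subset_V k ok x hx). Qed.

Lemma V_transitive a : ordinal a -> transitive (V a).
Proof.
intros oa x hx y hy; rewrite mem_V_rank in *; auto.
apply (proj1 oa _ hx), mem_rank; exists y; auto.
Qed.

Lemma ordinal_of_mem_V x : forall k, ordinal k -> ordinal x -> x ∈ V k -> x ∈ k.
Proof.
induction x as [x IH] using mem_ind; intros k ok ox hx.
apply mem_V in hx; destruct hx as [b [hb hx]].
assert (ob := ordinal_mem k b ok hb).
destruct (ordinal_sub x b ox ob) as [h | ->]; [| |exact hb].
- intros y hy; eauto using ordinal_mem.
- exact (proj1 ok b hb x h).
Qed.

(** * Unbounded subsets of regular cardinals *)

Definition unbounded (k : ZFSet) (P : ZFSet -> Prop) : Prop :=
  forall b, b ∈ k -> exists h, h ∈ k /\ P h /\ ~ h ∈ b.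

(** Two bounds have a maximum. *)
Lemma unbounded_split k P (c : ZFSet -> Prop) :
  ordinal k -> unbounded k P ->
  unbounded k (fun x => P x /\ c x) \/ unbounded k (fun x => P x /\ ~ c x).
Proof.
intros ok hP.
destruct (classic (unbounded k (fun x => P x /\ c x))) as [h | hT]; auto.
destruct (classic (unbounded k (fun x => P x /\ ~ c x))) as [h | hF]; auto.
exfalso.
apply not_all_ex_not in hT; destruct hT as [b hT].
apply imply_to_and in hT; destruct hT as [hb hT].
apply not_all_ex_not in hF; destruct hF as [b' hF].
apply imply_to_and in hF; destruct hF as [hb' hF].
assert (hm : exists m, m ∈ k /\ b ⊆ m /\ b' ⊆ m).
{ assert (ob := ordinal_mem k b ok hb); assert (ob' := ordinal_mem k b' ok hb').
  destruct (ordinal_total b b' ob ob') as [h | [h | h]].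
  - exists b'; split; [|split]; [exact hb' | exact (proj1 ob' b h) | intros x; auto].
  - subst b'; exists b; split; [|split]; [exact hb | intros x; auto ..].
  - exists b; split; [|split]; [exact hb | intros x; auto | exact (proj1 ob b' h)]. }
destruct hm as [m [hm [sb sb']]]; destruct (hP m hm) as [h [hk [Ph hn]]].
destruct (classic (c h)) as [hc | hc];
  [apply hT | apply hF]; exists h; repeat split; auto.
Qed.

(** The transitive collapse [g] of [H] is an injection of [H] onto the ordinal
    [g k], and [g k] is at most [k].  If it were smaller, the inverse of [g] would be a
    function from an element of [k] onto an unbounded subset of [k]. *)
Lemma unbounded_equinumerous k H :
  ordinal k -> regular k -> H ⊆ k -> unbounded k (fun x => x ∈ H) ->
  equinumerous H k.
Proof.
intros ok rk Hk uH.
destruct (mem_recursion k (fun x f => image f (sep x (fun y => y ∈ H)))) as [g hg].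
{ intros x f f' hf; apply set_ext; intros z; rewrite !mem_image.
  split; intros [y [hy ->]]; exists y; split; auto;
    apply mem_sep in hy; destruct hy as [hy _]; [|symmetry]; auto. }
assert (mem_g : forall x z, z ∈ g x <-> exists y, y ∈ x /\ y ∈ H /\ z = g y).
{ intros x z; rewrite hg, mem_image; split.
  - intros [y [hy hz]]; apply mem_sep in hy; exists y; tauto.
  - intros [y [hy [hyH hz]]]; exists y; rewrite mem_sep; auto. }
assert (tg : forall x, ordinal x -> transitive (g x)).
{ intros x ox z hz w hw; apply mem_g in hz; destruct hz as [y [hy [_ ->]]].
  apply mem_g in hw; destruct hw as [u [hu hw]].
  apply mem_g; exists u; split; [exact (proj1 ox y hy u hu) | exact hw]. }
assert (og : forall x, ordinal x -> ordinal (g x)).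
{ intros x ox; split; [auto|]; intros z hz; apply mem_g in hz.
  destruct hz as [y [hy [_ ->]]]; eauto using ordinal_mem. }
assert (le_g : forall x, ordinal x -> g x ∈ x \/ g x = x).
{ induction x as [x IH] using mem_ind; intros ox.
  apply ordinal_sub; auto; intros z hz; apply mem_g in hz.
  destruct hz as [y [hy [_ ->]]].
  destruct (IH y hy (ordinal_mem x y ox hy)) as [h | ->]; [|exact hy].
  exact (proj1 ox y hy _ h). }
assert (inj : injective_on g H).
{ assert (no : forall x y, x ∈ H -> x ∈ y -> g x <> g y).
  { intros x y hx hxy e; apply (mem_irrefl (g y)); rewrite <- e at 1.
    apply mem_g; eauto. }
  intros x y hx hy e.
  destruct (ordinal_total x y) as [h | [h | h]]; eauto using ordinal_mem.
  - destruct (no x y hx h e).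
  - destruct (no y x hy h (eq_sym e)). }
assert (gk : g k = k).
{ destruct (le_g k ok) as [hlt | e]; [exfalso | exact e].
  assert (he : forall z, exists h, z ∈ g k -> h ∈ H /\ z = g h).
  { intros z; destruct (classic (z ∈ g k)) as [hz | hz].
    - apply mem_g in hz; destruct hz as [y hy]; exists y; tauto.
    - exists k; contradiction. }
  set (e := fun z => proj1_sig (constructive_indefinite_description _ (he z))).
  assert (he' : forall z, z ∈ g k -> e z ∈ H /\ z = g (e z)).
  { intros z; exact (proj2_sig (constructive_indefinite_description _ (he z))). }
  destruct (rk (g k) e hlt) as [c [hc hb]].
  { intros z hz; apply Hk, he'; exact hz. }
  destruct (uH c hc) as [h [hk [hH hn]]]; apply hn.
  assert (hz : g h ∈ g k) by (apply mem_g; eauto).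
  destruct (he' _ hz) as [h1 h2].
  rewrite (inj h (e (g h)) hH h1 h2); auto. }
exists g; split; [|split]; [|exact inj|].
- intros x hx; rewrite <- gk; apply mem_g; eauto.
- intros y hy; rewrite <- gk in hy; apply mem_g in hy.
  destruct hy as [x [_ [hx ->]]]; eauto.
Qed.

(** * Formulas *)

Definition fImp (p q : formula) : formula := fNot (fAnd p (fNot q)).
Definition fAll (p : formula) : formula := fNot (fEx (fNot p)).

Lemma sat_fImp M rho p q :
  sat M rho (fImp p q) <-> (sat M rho p -> sat M rho q).
Proof. simpl; tauto. Qed.

Lemma sat_fAll M rho p :
  sat M rho (fAll p) <-> forall x, x ∈ dom M -> sat M (scons x rho) p.
Proof.
simpl; split.
- intros h x hx; apply NNPP; intros n; apply h; eauto.
- intros h [x [hx n]]; auto.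
Qed.

Definition fTransitive (i : nat) : formula :=
  fAll (fImp (fE 0 (S i)) (fAll (fImp (fE 0 1) (fE 0 (S (S i)))))).

Definition fOrdinal (i : nat) : formula :=
  fAnd (fTransitive i) (fAll (fImp (fE 0 (S i)) (fTransitive 0))).

Lemma sat_fTransitive M rho i :
  sat M rho (fTransitive i) <-> transitive_in M (rho i).
Proof.
unfold fTransitive; rewrite sat_fAll; split; intros h y hy.
- intros hr z hz hzy; specialize (h y hy).
  rewrite sat_fImp, sat_fAll in h; specialize (h hr z hz).
  rewrite sat_fImp in h; exact (h hzy).
- rewrite sat_fImp, sat_fAll; intros hr z hz; rewrite sat_fImp; intros hzy.
  exact (h y hy hr z hz hzy).
Qed.

Lemma sat_fOrdinal M rho i :
  sat M rho (fOrdinal i) <-> ordinal_in M (rho i).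
Proof.
unfold fOrdinal, ordinal_in; cbn [sat].
rewrite sat_fTransitive, sat_fAll.
split; intros [h1 h2]; split; auto; intros y hy.
- intros hr; specialize (h2 y hy); rewrite sat_fImp, sat_fTransitive in h2; auto.
- rewrite sat_fImp, sat_fTransitive; intros hr; exact (h2 y hy hr).
Qed.

(** The colour of a pair as read off from a code [prd M] of the colouring: for
    distinct [x] and [y], and a set of unordered pairs, [{x, y}] is its only
    possible member with elements [x] and [y]. *)
Definition linked (M : structure) (x y : ZFSet) : Prop :=
  exists p, p ∈ dom M /\ prd M p /\ rel M x p /\ rel M y p.

Definition fLinked (i j : nat) : formula :=
  fEx (fAnd (fS 0) (fAnd (fE (S i) 0) (fE (S j) 0))).

(** * The new ordinal and its colours *)

Lemma ordinal_in_V k Q x :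
  ordinal k -> x ∈ V k -> (ordinal_in (V_structure k Q) x <-> ordinal x).
Proof.
intros ok hx; assert (tV := V_transitive k ok); split; intros [h1 h2]; split.
- intros y hy z hz; exact (h1 y (tV x hx y hy) hy z (tV y (tV x hx y hy) z hz) hz).
- intros y hy z hz w hw; assert (hy' := tV x hx y hy); assert (hz' := tV y hy' z hz).
  exact (h2 y hy' hy z hz' hz w (tV z hz' w hw) hw).
- intros y _ hy z _ hz; exact (h1 y hy z hz).
- intros y _ hy z _ hz w _ hw; exact (h2 y hy z hz w hw).
Qed.

(** The isomorphism from the ordinals of [N] onto the height fixes every
    [x ∈ k], because the extension adds no elements to [x]; so the ordinal
    that it sends to [k] has all [x ∈ k] below it. *)
Lemma new_ordinal k Q N o :
  ordinal k -> eee (V_structure k Q) N -> ordinal_height N o -> k ∈ o ->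
  exists d, d ∈ dom N /\ ordinal_in N d /\ forall x, x ∈ k -> rel N x d.
Proof.
intros ok [[sub el] [_ ee]] [oo [f [fin [fsur [_ fiso]]]]] hko; simpl in *.
assert (kV : forall x, x ∈ k -> x ∈ V k) by (intros; apply ordinal_mem_V; auto).
assert (kN : forall x, x ∈ k -> ordinal_in N x).
{ intros x hx; rewrite <- (sat_fOrdinal N (fun _ => x) 0).
  apply el; [auto|]; apply sat_fOrdinal, ordinal_in_V; eauto using ordinal_mem. }
assert (ffix : forall x, x ∈ k -> f x = x).
{ induction x as [x IH] using mem_ind; intros hx.
  assert (xk := proj1 ok x hx).
  apply set_ext; intros z; split; intros hz.
  - assert (hzo : z ∈ o) by (apply (proj1 oo (f x)); auto).
    destruct (fsur z hzo) as [y [hy [oy ey]]]; subst z.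
    apply fiso in hz; auto.
    destruct (proj2 (ee x (kV x hx) y) (conj hy hz)) as [_ hyx].
    rewrite IH; auto.
  - assert (hr : rel N z x) by (apply (ee x (kV x hx) z); auto).
    rewrite <- (IH z hz (xk z hz)); apply fiso; auto. }
destruct (fsur k hko) as [d [hd [od ed]]].
exists d; split; [exact hd|]; split; [exact od|].
intros x hx; apply fiso; auto; rewrite ed, ffix; auto.
Qed.

Definition code (k : ZFSet) (F : ZFSet -> ZFSet -> bool) : ZFSet :=
  sep (V k) (fun p => exists x y, y ∈ k /\ x ∈ y /\ F x y = true /\ p = pair x y).

Lemma linked_code k F x y :
  ordinal k -> regular k -> y ∈ k -> x ∈ y ->
  (linked (V_structure k (code k F)) x y <-> F x y = true).
Proof.
intros ok rk hy hxy; assert (oy := ordinal_mem k y ok hy).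
unfold linked; simpl; split.
- intros [p [_ [hp [hxp hyp]]]]; apply mem_sep in hp.
  destruct hp as [_ [u [v [hv [huv [hF ->]]]]]].
  assert (ov := ordinal_mem k v ok hv).
  apply mem_pair in hxp; apply mem_pair in hyp.
  destruct hxp as [-> | ->], hyp as [-> | ->]; auto.
  + destruct (mem_irrefl _ hxy).
  + destruct (mem_irrefl _ (proj1 ov u huv v hxy)).
  + destruct (mem_irrefl _ hxy).
- intros hF.
  (* Regularity, applied to a constant function on the nonempty set [y], gives
     an ordinal [c ∈ k] above [y]; then [pair x y] is included in [V c]. *)
  destruct (rk y (fun _ => y) hy) as [c [hc hyc]]; [intros z _; exact hy|].
  specialize (hyc x hxy); assert (oc := ordinal_mem k c ok hc).
  assert (hpV : pair x y ∈ V k).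
  { apply mem_V; exists c; split; [exact hc|].
    intros z hz; apply ordinal_subset_V; [exact oc|]; apply mem_pair in hz.
    destruct hz as [-> | ->]; [exact (proj1 oc y hyc x hxy) | exact hyc]. }
  exists (pair x y); split; [exact hpV|]; split.
  + apply mem_sep; split; [exact hpV|]; exists x, y; auto.
  + split; apply mem_pair; auto.
Qed.

Definition fRealized : formula :=
  fEx (fAnd (fOrdinal 0) (fAnd (fE 1 0)
    (fAnd (fAll (fImp (fE 0 3) (fLinked 0 1)))
          (fAll (fImp (fE 0 4) (fNot (fLinked 0 1))))))).

Lemma sat_fRealized M b A B :
  sat M (scons b (scons A (fun _ => B))) fRealized <->
  exists d, d ∈ dom M /\ ordinal_in M d /\ rel M b d /\
    (forall x, x ∈ dom M -> rel M x A -> linked M x d) /\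
    (forall x, x ∈ dom M -> rel M x B -> ~ linked M x d).
Proof.
unfold fRealized; cbn [sat]; split; intros [d [hd [h1 [h2 [h3 h4]]]]];
  exists d; (split; [exact hd|]).
- rewrite sat_fOrdinal in h1; rewrite sat_fAll in h3, h4.
  split; [exact h1|]; split; [exact h2|]; split; intros x hx hr.
  + specialize (h3 x hx); rewrite sat_fImp in h3; exact (h3 hr).
  + specialize (h4 x hx); rewrite sat_fImp in h4; exact (h4 hr).
- rewrite sat_fOrdinal, !sat_fAll.
  split; [exact h1|]; split; [exact h2|].
  split; intros x hx; rewrite sat_fImp; intros hr; [exact (h3 x hx hr) | exact (h4 x hx hr)].
Qed.

(** Take [c x] to be the colour in [N] of [x] and the new ordinal.  Below [b],
    [c] is given by two elements [A] and [B] of [V k], and the new ordinal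
    shows that [N] satisfies [fRealized] for them. *)
Lemma limit_colouring k F :
  unfoldable k ->
  exists c : ZFSet -> Prop, forall b, b ∈ k ->
    exists d, d ∈ k /\ b ∈ d /\ forall x, x ∈ b -> (F x d = true <-> c x).
Proof.
intros [[[ok _] [_ [rk _]]] unf].
destruct (unf (succ k) (code k F) (ordinal_succ k ok)) as [N [he [_ [o [ho so]]]]].
{ intros p hp; apply mem_sep in hp; tauto. }
assert (hko : k ∈ o) by (apply so, mem_succ; auto).
destruct (new_ordinal k _ N o ok he ho hko) as [d [hd [od hkd]]].
destruct he as [[sub el] [_ ee]]; simpl in sub, ee.
exists (fun x => linked N x d); intros b hb.
assert (ob := ordinal_mem k b ok hb).
set (A := sep b (fun x => linked N x d)).
set (B := sep b (fun x => ~ linked N x d)).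
assert (sV : forall a, a ⊆ b -> a ∈ V k).
{ intros a ha; apply mem_V; exists b; split; [exact hb|].
  intros x hx; apply ordinal_subset_V; auto. }
assert (hA : A ∈ V k) by (apply sV; intros x hx; apply mem_sep in hx; tauto).
assert (hB : B ∈ V k) by (apply sV; intros x hx; apply mem_sep in hx; tauto).
assert (hs : sat (V_structure k (code k F)) (scons b (scons A (fun _ => B))) fRealized).
{ apply el.
  - intros [|[|i]]; simpl; auto using ordinal_mem_V.
  - apply sat_fRealized; exists d.
    split; [exact hd|]; split; [exact od|]; split; [auto|]; split.
    + intros x hx hr; destruct (proj2 (ee A hA x) (conj hx hr)) as [_ h].
      apply mem_sep in h; tauto.
    + intros x hx hr; destruct (proj2 (ee B hB x) (conj hx hr)) as [_ h].
      apply mem_sep in h; tauto. }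
apply sat_fRealized in hs; destruct hs as [e [he [oe [hbe [eA eB]]]]]; simpl in *.
assert (hek : e ∈ k).
{ apply ordinal_of_mem_V; auto; exact (proj1 (ordinal_in_V k _ e ok he) oe). }
assert (oe' := ordinal_mem k e ok hek).
exists e; split; [exact hek|]; split; [exact hbe|]; intros x hx.
assert (hxe := proj1 oe' b hbe x hx).
assert (hxV : x ∈ V k) by exact (ordinal_mem_V k x ok (proj1 ok e hek x hxe)).
rewrite <- (linked_code k F x e ok rk hek hxe); split; intros h.
- apply NNPP; intros n; apply (eB x hxV); [apply mem_sep; auto | exact h].
- apply eA; [exact hxV | apply mem_sep; auto].
Qed.

(** * Homogeneous sets *)

(** A point [d] with the right colours to all points below [b] is itself kept
    unless some point between [b] and [d] is. *)
Lemma end_homogeneous_unbounded k (F : ZFSet -> ZFSet -> bool) (c : ZFSet -> Prop) :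
  (forall b, b ∈ k ->
    exists d, d ∈ k /\ b ∈ d /\ forall x, x ∈ b -> (F x d = true <-> c x)) ->
  ordinal k ->
  exists P : ZFSet -> Prop, unbounded k P /\
    forall x y, P x -> P y -> x ∈ y -> (F x y = true <-> c x).
Proof.
intros hc ok.
destruct (mem_recursion True
  (fun x P => forall y, y ∈ x -> P y -> (F y x = true <-> c y))) as [P hP].
{ intros x f g h; apply propositional_extensionality.
  split; intros k0 y hy; specialize (k0 y hy); rewrite (h y hy) in *; exact k0. }
exists P; split.
- intros b hb; destruct (hc b hb) as [d [hd [hbd hcd]]].
  destruct (classic (exists h, h ∈ d /\ P h /\ ~ h ∈ b)) as [[h [hhd hh]] | n].
  + exists h; split; [exact (proj1 ok d hd h hhd) | exact hh].
  + exists d; split; [exact hd|]; split.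
    * rewrite hP; intros y hy Py; apply hcd; apply NNPP; intros hn; apply n; eauto.
    * intros hdb.
      exact (mem_irrefl b (proj1 (ordinal_mem k b ok hb) d hdb b hbd)).
- intros x y Px Py hxy; rewrite hP in Py; auto.
Qed.

Lemma unbounded_homogeneous k F (P : ZFSet -> Prop) b :
  ordinal k -> regular k -> unbounded k P ->
  (forall x y, P x -> P y -> x ∈ y -> F x y = b) ->
  exists H, H ⊆ k /\ equinumerous H k /\
    exists c : bool, forall x y, x ∈ H -> y ∈ H -> x ∈ y -> F x y = c.
Proof.
intros ok rk uP hP; exists (sep k P).
assert (hk : sep k P ⊆ k) by (intros x hx; apply mem_sep in hx; tauto).
split; [exact hk|]; split.
- apply unbounded_equinumerous; auto.
  intros a ha; destruct (uP a ha) as [h [h1 [h2 h3]]].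
  exists h; rewrite mem_sep; auto.
- exists b; intros x y hx hy; apply mem_sep in hx; apply mem_sep in hy.
  apply hP; tauto.
Qed.

Theorem proposition1p6 (kappa : ZFSet) :
  unfoldable kappa -> weakly_compact kappa.
Proof.
intros u; assert (u' := u); destruct u' as [[ck [uk [rk _]]] _].
split; [exact ck|]; split; [exact uk|]; intros F.
assert (ok := proj1 ck).
destruct (limit_colouring kappa F u) as [c hc].
destruct (end_homogeneous_unbounded kappa F c hc ok) as [P [uP hP]].
destruct (unbounded_split kappa P c ok uP) as [h | h].
- apply (unbounded_homogeneous kappa F _ true ok rk h).
  intros x y [Px cx] [Py _] hxy; apply (hP x y); auto.
- apply (unbounded_homogeneous kappa F _ false ok rk h).
  intros x y [Px cx] [Py _] hxy; specialize (hP x y Px Py hxy).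
  destruct (F x y); [tauto | reflexivity].
Qed.
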